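(* Applying closed e-BH to the running maxima of arbitrarily dependent $e$-processes does not control the FDR at level $\alpha$. Precisely: for every $\alpha\in(0,1)$ there exist an integer $K\ge 1$, a measurable space $(\Omega,\mathcal F)$ with a filtration $(\mathcal F_t)_{t\ge 0}$ (discrete time), hypotheses $H_1,\dots,H_K$ (sets of probability measures on $(\Omega,\mathcal F)$), processes $(E^k_t)_{t\ge 0}$, $k=1,\dots,K$, each $E^k$ being an $e$-process for $H_k$ with respect to $(\mathcal F_t)$, a true data-generating probability measure $P^*$, and a time $t\ge 1$, such that, with $M^k_t=\max_{1\le s\le t}E^k_s$ and with $\mathcal R_t$ the set of hypotheses rejected by closed e-BH at level $\alpha$ applied to $(M^1_t,\dots,M^K_t)$, $$\mathbb E_{P^*}\left[\frac{|\mathcal R_t\cap\mathcal N|}{|\mathcal R_t|\vee 1}\right]>\alpha,$$ where $\mathcal N=\{k: P^*\in H_k\}$.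
   Context: Hypotheses are sets of probability measures; $H_k$ is true if $P^*\in H_k$. An $e$-process for a hypothesis $H$ with respect to a filtration $(\mathcal F_t)_{t\ge0}$ is a nonnegative process $(E_t)_{t\ge 0}$ adapted to $(\mathcal F_t)$, with $E_0=1$, such that $\mathbb E_P[E_\tau]\le 1$ for every (finite) stopping time $\tau$ and every $P\in H$. All $e$-processes are adapted to one common filtration; their joint dependence is otherwise arbitrary. Closed e-BH at level $\alpha$ applied to $x=(x_1,\dots,x_K)\in[0,\infty)^K$: let $\mathcal C_\alpha(x)$ be the collection of all $R\subseteq\{1,\dots,K\}$ such that for every nonempty $S\subseteq\{1,\dots,K\}$, $$\frac1{|S|}\sum_{i\in S}x_i\ \ge\ \frac{|R\cap S|}{\alpha(|R|\vee 1)}.$$ (The collection always contains $\emptyset$.) Closed e-BH rejects a set in $\mathcal C_\alpha(x)$ of maximal cardinality, chosen by any fixed measurable selection rule; the claim is for every such rule. *)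

(* Defs.v *)
From HB Require Import structures.
From mathcomp Require Import all_boot all_order all_algebra.
From mathcomp Require Import all_classical all_reals all_analysis.

Set Implicit Arguments.
Unset Strict Implicit.
Unset Printing Implicit Defensive.

Import Order.TTheory GRing.Theory Num.Theory.

Local Open Scope classical_set_scope.
Local Open Scope ring_scope.

Section processes.
Context {d : measure_display} {Omega : measurableType d} {R : realType}.
Implicit Types (F : nat -> set (set Omega)) (E : nat -> Omega -> R).

Definition filtration F :=
  [/\ forall t, sigma_algebra [set: Omega] (F t),
      forall t, F t `<=` measurable &
      forall s t, (s <= t)%N -> F s `<=` F t].

Definition adapted F E :=
  forall t (B : set R), measurable B -> F t (E t @^-1` B).

(* Taking values in nat, these stopping times are finite everywhere. *)
Definition stopping_time F (tau : Omega -> nat) :=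
  forall t, F t [set w | (tau w <= t)%N].

Definition e_process F (H : set (probability Omega R)) E :=
  [/\ adapted F E,
      forall t w, 0 <= E t w,
      forall w, E 0%N w = 1 &
      forall tau, stopping_time F tau ->
        forall P : probability Omega R, H P ->
          ('E_P[fun w => E (tau w) w] <= 1)%E].

(* max_{1 <= s <= t} E_s; the default value E_1 of the big operator is itself
   in the range as soon as 1 <= t, the only case of interest. *)
Definition running_max E (t : nat) (w : Omega) : R :=
  \big[Num.max/E 1%N w]_(1 <= s < t.+1) E s w.

End processes.

Section closed_eBH.
Context {R : realType} {K : nat}.
Implicit Types (alpha : R) (x : K.-tuple R) (A S : {set 'I_K}).

Definition closed_eBH_collection alpha x : set {set 'I_K} :=
  [set A | forall S, S != finset.set0 ->
     (\sum_(i in S) tnth x i) / #|S|%:R >=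
     #|A :&: S|%:R / (alpha * (maxn #|A| 1)%:R)].

Definition nneg_orthant : set (K.-tuple R) :=
  [set x | forall i, 0 <= tnth x i].

(* A rule is specified on [0, +oo)^K only; its values elsewhere, about which
   nothing is assumed, are irrelevant. *)
Definition closed_eBH_rule alpha (rej : K.-tuple R -> {set 'I_K}) :=
  (forall A, measurable (nneg_orthant `&` [set x | rej x = A])) /\
  (forall x, nneg_orthant x ->
     closed_eBH_collection alpha x (rej x) /\
     forall A, closed_eBH_collection alpha x A -> (#|A| <= #|rej x|)%N).

Definition false_discovery_proportion (N A : {set 'I_K}) : R :=
  #|A :&: N|%:R / (maxn #|A| 1)%:R.

End closed_eBH.

Definition true_hypotheses {d : measure_display} {Omega : measurableType d}
    {R : realType} {K : nat} (H : 'I_K -> set (probability Omega R))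
    (P : probability Omega R) : {set 'I_K} :=
  [set k | `[< H k P >]]%SET.

(* Main.v *)
Require Import Defs.
From mathcomp Require Import all_boot all_order all_algebra.
From mathcomp Require Import all_classical all_reals all_analysis.
From mathcomp Require Import measurable_realfun ring lra.

Set Implicit Arguments.
Unset Strict Implicit.
Unset Printing Implicit Defensive.

Import Order.TTheory GRing.Theory Num.Theory.

Local Open Scope classical_set_scope.
Local Open Scope ring_scope.

(** Two null e-processes make two independent all-or-nothing bets: with
    [c = 2 / alpha - 1], each stays at 1 until time 1 and is then multiplied by
    [c] with probability [q = 1 / c], or else falls to 0.  Each bet is fair.

    A losing bet still leaves its running maximum at 1.  With two hypotheses,
    closed e-BH rejects something exactly when the two values add up to at least
    [2 / alpha] ([closed_eBH_two_nonempty]), and [c + 1 = 2 / alpha]: one win and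
    the 1 remembered from a lost bet are enough, although at time 2 itself the
    two e-values would then only add up to [c < 2 / alpha].  Both hypotheses being
    true, the FDR is the probability of at least one win, [1 - (1 - q) ^+ 2].
    From [alpha * (1 + q) = 2 * q], this exceeds [alpha] because
    [(2 * q - q ^+ 2) * (1 + q) = 2 * q + q ^+ 2 * (1 - q) > 2 * q]. *)

Section one_bet.
Context {d : measure_display} {Omega : measurableType d} {R : realType}.

Definition reveal_at_2 (t : nat) : set (set Omega) :=
  if (t <= 1)%N then [set set0; setT] else measurable.

Definition bet_at_2 (c : R) (A : set Omega) (t : nat) (w : Omega) : R :=
  if (t <= 1)%N then 1 else c * \1_A w.

Lemma reveal_at_2_filtration : filtration reveal_at_2.
Proof.
rewrite /reveal_at_2; split=> [t|t|s t st].
- case: ifP => _; last exact: sigma_algebra_measurable.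
  split=> [|B [->|->]|G FG]; first by left.
  + by right; rewrite setD0.
  + by left; rewrite setDv.
  have [[k Gk]|noG] := pselect (exists k, G k = setT).
    by right; apply/seteqP; split=> // w _; exists k => //; rewrite Gk.
  left; rewrite bigcup0// => k _.
  by case: (FG k) => // GT; case: noG; exists k.
- by case: ifP => _ // B [->|->]; [exact: measurable0|exact: measurableT].
- case: ifP => s1; case: ifP => t1 //.
  + by move=> B [->|->]; [exact: measurable0|exact: measurableT].
  + by rewrite (leq_trans st t1) in s1.
Qed.

(** The event that [tau] stops by time 1 belongs to the trivial sigma-algebra,
    so whether to sit out the bet is decided before seeing its outcome. *)
Lemma stopping_time_reveal_at_2 tau : stopping_time reveal_at_2 tau ->
  (forall w, (tau w <= 1)%N) \/ (forall w, (1 < tau w)%N).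
Proof.
move=> /(_ 1%N) [] /seteqP [T0 T1]; [right|left] => w.
- by rewrite ltnNge; apply/negP => /T0.
- exact: (T1 w I).
Qed.

(** A stopping time either stops everywhere before the bet, at value 1, or
    everywhere after it, at a value whose mean is [c * P A]. *)
Lemma bet_at_2_e_process (c : R) (A : set Omega) (H : set (probability Omega R)) :
  0 <= c -> measurable A ->
  (forall P : probability Omega R, H P -> (c%:E * P A <= 1)%E) ->
  e_process reveal_at_2 H (bet_at_2 c A).
Proof.
move=> c0 mA fair; rewrite /bet_at_2.
have mcA : measurable_fun setT (fun w => c * \1_A w : R).
  exact: measurable_funM.
split=> //.
- move=> t B mB; rewrite /reveal_at_2 /bet_at_2; case: ifP => t1.
    have [B1|B1] := pselect (B 1).
    + by right; apply/seteqP; split.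
    + by left; apply/seteqP; split.
  by rewrite -[X in measurable X]setTI; exact: mcA.
- by move=> t w; case: ifP => // _; rewrite mulr_ge0.
move=> tau /stopping_time_reveal_at_2 tau12 P HP.
case: tau12 => tauw.
  rewrite [X in 'E_P[X]%E](_ : _ = cst 1) ?expectation_cst//.
  by apply/funext => w; rewrite tauw.
rewrite [X in 'E_P[X]%E](_ : _ = (fun w => c * \1_A w)); last first.
  by apply/funext => w; rewrite leqNgt tauw.
rewrite unlock; under eq_integral do rewrite EFinM.
rewrite ge0_integralZl//; last exact/measurable_EFinP.
by rewrite integral_indic// setIT; exact: fair.
Qed.

Lemma running_max_bet_at_2 c A w :
  running_max (bet_at_2 c A) 2 w = Num.max 1 (c * \1_A w).
Proof.
rewrite /running_max big_ltn// big_ltn// big_geq// /bet_at_2/=.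
by rewrite [Num.max _ 1]maxC maxA maxxx.
Qed.

End one_bet.

Section rejections.
Context {R : realType}.

(** This is the constraint at the full set of hypotheses: every [A] lies inside
    it, so for nonempty [A] the right-hand side there is [1 / alpha], whatever
    the size of [A]. *)
Lemma closed_eBH_mean_ge K (alpha : R) (x : K.-tuple R) (A : {set 'I_K}) :
  closed_eBH_collection alpha x A -> A != finset.set0 ->
  alpha^-1 <= (\sum_i tnth x i) / K%:R.
Proof.
move=> CA A0.
have A_gt0 : (0 < #|A|)%N by rewrite card_gt0.
have T0 : [set: 'I_K]%SET != finset.set0.
  by apply: contraNneq A0 => T0; rewrite -finset.subset0 -T0 finset.subsetT.
have := CA _ T0; rewrite finset.setIT cardsT card_ord.
rewrite (maxn_idPl _)// invfM mulrCA divff ?mulr1; last by rewrite pnatr_eq0 -lt0n.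
by rewrite (eq_bigl xpredT)// => i; rewrite inE.
Qed.

Lemma closed_eBH_singleton K (alpha : R) (x : K.-tuple R) (i : 'I_K) :
  nneg_orthant x ->
  (forall S : {set 'I_K}, i \in S ->
     alpha^-1 <= (\sum_(k in S) tnth x k) / #|S|%:R) ->
  closed_eBH_collection alpha x [set i]%SET.
Proof.
move=> x0 mean_ge S _; rewrite cards1 mulr1.
have [iS|iS] := boolP (i \in S).
  have /finset.setIidPl -> : [set i]%SET \subset S by rewrite finset.sub1set.
  by rewrite cards1 div1r; exact: mean_ge.
have -> : ([set i] :&: S)%SET = finset.set0.
  by apply/finset.setP => k; rewrite !inE; case: eqP => // ->; exact/negbTE.
by rewrite cards0 mul0r divr_ge0// sumr_ge0.
Qed.

(** If the mean is at least [1 / alpha], so is the larger value, and its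
    singleton then meets the constraints at both sets that contain it; maximality
    of the cardinality makes the selected set nonempty as well. *)
Lemma closed_eBH_two_nonempty (alpha : R) (rej : 2.-tuple R -> {set 'I_2})
    (x : 2.-tuple R) :
  0 < alpha -> closed_eBH_rule alpha rej -> nneg_orthant x ->
  (rej x != finset.set0) = (2 / alpha <= tnth x 0 + tnth x 1).
Proof.
move=> a0 [_ rejP] x0; have [rejC rejmax] := rejP x x0.
have sum2 : \sum_i tnth x i = tnth x 0 + tnth x 1.
  by rewrite big_ord_recl big_ord1; congr (_ + tnth x _); apply: val_inj.
apply/idP/idP => [/(closed_eBH_mean_ge rejC)|sum_ge].
  by rewrite ler_pdivlMr// sum2 mulrC.
pose i : 'I_2 := if tnth x 1 <= tnth x 0 then 0 else 1.
suff /rejmax : closed_eBH_collection alpha x [set i]%SET.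
  by rewrite cards1 card_gt0.
have xi_ge : alpha^-1 <= tnth x i.
  by rewrite /i; case: (leP (tnth x 1)) => x01; lra.
apply: closed_eBH_singleton => // S iS.
have [/eqP S2|S2] := boolP (#|S| == 2%N).
  have -> : S = [set: 'I_2]%SET.
    by apply/eqP; rewrite eqEcard finset.subsetT cardsT card_ord S2.
  rewrite cardsT card_ord (eq_bigl xpredT) => [|k]; last by rewrite inE.
  by rewrite sum2 ler_pdivlMr// mulrC.
have S1 : #|S| = 1%N.
  apply/eqP; rewrite eqn_leq -ltnS ltn_neqAle S2/=.
  rewrite -[X in (_ <= X)%N](card_ord 2) max_card card_gt0.
  by apply/set0Pn; exists i.
have /eqP <- : [set i]%SET == S by rewrite eqEcard finset.sub1set iS cards1 S1.
by rewrite big_set1 cards1 divr1.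
Qed.

Lemma false_discovery_proportion_global_null K (A : {set 'I_K}) :
  false_discovery_proportion [set: 'I_K]%SET A = (A != finset.set0)%:R :> R.
Proof.
rewrite /false_discovery_proportion finset.setIT; have [->|A0] := eqVneq.
  by rewrite cards0 mul0r.
rewrite -card_gt0 in A0.
by rewrite (maxn_idPl _)// divff// pnatr_eq0 -lt0n.
Qed.

End rejections.

Definition jump (k : 'I_2) : set (bool * bool) :=
  if k == 0 then [set true] `*` setT else setT `*` [set true].

Section two_coins.
Context {R : realType} (q : R).
Hypothesis q01 : 0 <= q <= 1.

Definition two_coins : probability (bool * bool)%type R :=
  (bernoulli_prob q \x bernoulli_prob q)%E.

Lemma measurable_jump k : measurable (jump k).
Proof. by rewrite /jump; case: ifP => _; exact: measurableX. Qed.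

Lemma two_coins_jump k : two_coins (jump k) = q%:E.
Proof.
have coin : bernoulli_prob q [set true] = q%:E.
  by rewrite bernoulli_probE// !diracE mem_set// memNset// mule1 mule0 adde0.
rewrite /jump; case: ifP => _; rewrite [LHS]product_measure1E//=.
- by rewrite [X in (X * _)%E]coin [X in (_ * X)%E]probability_setT mule1.
- by rewrite [X in (_ * X)%E]coin [X in (X * _)%E]probability_setT mul1e.
Qed.

(** No jump means that both coins fall on [false], which is a product event. *)
Lemma two_coins_some_jump :
  two_coins (jump 0 `|` jump 1) = (1 - (1 - q) ^+ 2)%:E.
Proof.
have tail : bernoulli_prob q [set false] = (1 - q)%:E.
  by rewrite bernoulli_probE// !diracE memNset// mem_set// mule1 mule0 add0e.
have -> : jump 0 `|` jump 1 = ~` ([set false] `*` [set false]).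
  by rewrite /jump/=; apply/seteqP; split=> -[[] []]; rewrite /setX/setC/setU/=;
    intuition congruence.
rewrite probability_setC; last exact: measurableX.
rewrite [X in (_ - X)%E]product_measure1E//.
by rewrite [X in (X * _)%E]tail [X in (_ * X)%E]tail -EFinM -EFinB expr2.
Qed.

End two_coins.

Theorem corollary1 (R : realType) (alpha : R) (halpha : 0 < alpha < 1) :
  exists (K : nat) (d : measure_display) (Omega : measurableType d)
    (F : nat -> set (set Omega))
    (H : 'I_K -> set (probability Omega R))
    (E : 'I_K -> nat -> Omega -> R)
    (Pstar : probability Omega R)
    (t : nat),
    [/\ (1 <= K)%N,
        filtration F,
        forall k, e_process F (H k) (E k),
        (1 <= t)%N &
        forall rej : K.-tuple R -> {set 'I_K}, closed_eBH_rule alpha rej ->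
          (alpha%:E <
           'E_Pstar[fun w => false_discovery_proportion
              (true_hypotheses H Pstar)
              (rej [tuple running_max (E k) t w | k < K])])%E].
Proof.
have /andP[a0 a1] := halpha.
pose c : R := 2 / alpha - 1; pose q : R := c^-1.
have c1 : 1 < c by rewrite /c ltrBrDr ltr_pdivlMr//; lra.
have c0 : 0 < c by exact: lt_trans c1.
have q0 : 0 < q by rewrite invr_gt0.
have q1 : q < 1 by rewrite invf_lt1.
have q01 : 0 <= q <= 1 by rewrite !ltW.
have alphaE : alpha * (1 + q) = 2 * q.
  by rewrite /q /c; field; apply/andP; split; apply: lt0r_neq0; lra.
pose P := two_coins q.
exists 2%N, _, (bool * bool)%type, reveal_at_2, (fun=> [set P]),
  (fun k => bet_at_2 c (jump k)), P, 2%N.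
split=> //; first exact: reveal_at_2_filtration.
  move=> k; apply: bet_at_2_e_process; [exact: ltW|exact: measurable_jump|].
  by move=> _ ->; rewrite two_coins_jump// -EFinM divff// gt_eqF.
move=> rej rejP.
rewrite [X in 'E__[X]%E](_ : _ = \1_(jump 0 `|` jump 1)); last first.
  apply/funext => w.
  have -> : true_hypotheses (fun=> [set P]) P = [set: 'I_2]%SET.
    by apply/finset.setP => k; rewrite !inE; apply/asboolP.
  rewrite false_discovery_proportion_global_null (closed_eBH_two_nonempty a0 rejP).
    rewrite !tnth_mktuple !running_max_bet_at_2 !indicE in_setU.
    (* In the four cases the maxima add up to [c + c], [c + 1], [1 + c] and
       [1 + 1]; only the last, as [alpha < 1], stays below [2 / alpha]. *)
    have max1c : Num.max 1 c = c by apply/max_idPr; exact: ltW.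
    have -> : 2 / alpha = c + 1 by rewrite subrK.
    congr (_%:R); congr nat_of_bool.
    case: (w \in jump 0); case: (w \in jump 1);
      rewrite /= ?mulr1 ?mulr0 ?max1c ?(max_idPl ler01).
    - by apply/idP; lra.
    - by rewrite lexx.
    - by rewrite addrC lexx.
    - by apply/negbTE; rewrite -ltNge; lra.
  by move=> k; rewrite tnth_mktuple running_max_bet_at_2 le_max ler01.
rewrite expectation_indic; last by apply: measurableU; exact: measurable_jump.
rewrite two_coins_some_jump// lte_fin.
rewrite -(@ltr_pM2r _ (1 + q)) ?addr_gt0// alphaE -subr_gt0.
have -> : (1 - (1 - q) ^+ 2) * (1 + q) - 2 * q = q ^+ 2 * (1 - q) by ring.
by rewrite mulr_gt0 ?exprn_gt0// subr_gt0.
Qed.
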